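(* Let $q$ be a prime power and $n,k>1$ integers. Let $U$ be an $\mathbb{F}_q$-subspace of $\mathbb{F}_{q^n}^k$ with $\dim_{\mathbb{F}_q}(U)=\rho$, such that $L_U$ is an $(r,i)$-regular fat linear set with $i<n$. Consider the rank-metric code $\mathcal{C}$ associated with $U^{\perp'}$. Then $\mathcal{C}$ is a rank-metric $[nk-\rho,k,n-i]_{q^n/q}$ code. Such $\mathcal{C}$ has - $r(q^n-1)$ codewords of weight $n-i$; - $(|L_U|-r)(q^n-1)$ codewords of weight $n-1$; - $q^{nk}-1-|L_U|(q^n-1)$ codewords of weight $n$.
   Context: Linear sets: for an $\mathbb{F}_q$-subspace $U$ of $\mathbb{F}_{q^n}^k$, $L_U=\{\langle v\rangle_{\mathbb{F}_{q^n}}\colon v\in U,\ v\ne0\}\subseteq\mathrm{PG}(k-1,q^n)$, and the weight of a point $\langle v\rangle_{\mathbb{F}_{q^n}}$ is $\dim_{\mathbb{F}_q}(\langle v\rangle_{\mathbb{F}_{q^n}}\cap U)$. For integers $r\ge0$, $i\ge2$, $L_U$ is $(r,i)$-regular fat if it has exactly $r$ points of weight $i$, all its remaining points have weight one, and there is at least one point of weight one. Duality: let $\mathbb{V}=\mathbb{F}_{q^n}^k$, let $\sigma\colon\mathbb{V}\times\mathbb{V}\to\mathbb{F}_{q^n}$ be a fixed non-degenerate reflexive sesquilinear form, and $\sigma'(u,v)=\mathrm{Tr}_{q^n/q}(\sigma(u,v))$, where $\mathrm{Tr}_{q^n/q}(x)=x+x^q+\cdots+x^{q^{n-1}}$; $\sigma'$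 is regarded as a non-degenerate reflexive sesquilinear form on $\mathbb{V}$ as an $\mathbb{F}_q$-space. For an $\mathbb{F}_q$-subspace $U$, $U^{\perp'}$ is its orthogonal complement with respect to $\sigma'$. Codes: the rank (weight) of $v=(v_1,\ldots,v_N)\in\mathbb{F}_{q^n}^N$ is $w(v)=\dim_{\mathbb{F}_q}\langle v_1,\ldots,v_N\rangle_{\mathbb{F}_q}$. An $[N,k,d]_{q^n/q}$ code is a $k$-dimensional $\mathbb{F}_{q^n}$-subspace $\mathcal{C}$ of $\mathbb{F}_{q^n}^N$ with $d=\min\{w(v)\colon v\in\mathcal{C},\ v\ne0\}$. If $W$ is an $N$-dimensional $\mathbb{F}_q$-subspace of $\mathbb{F}_{q^n}^k$ with $\langle W\rangle_{\mathbb{F}_{q^n}}=\mathbb{F}_{q^n}^k$, the code associated with $W$ is the code in $\mathbb{F}_{q^n}^N$ (unique up to equivalence) having as generator matrix a $k\times N$ matrix whose columns form an $\mathbb{F}_q$-basis of $W$. Here $W=U^{\perp'}$, which satisfies this spanning condition because $i<n$.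
   Formalization: The minimum distance n-i is claimed only for r > 0: when r = 0 all points of L_U have weight one and the minimum distance is n-1, so the claim as printed fails; length, dimension and all three codeword counts are kept for every r ≥ 0. *)

(* Defs.v *)
From HB Require Import structures.
From mathcomp Require Import all_boot all_order all_algebra.
From mathcomp Require Import all_fingroup all_solvable all_field.

Set Implicit Arguments.
Unset Strict Implicit.
Unset Printing Implicit Defensive.

Import GRing.Theory.
Local Open Scope ring_scope.

(* F plays the role of F_q and L that of F_{q^n}, with q = #|F| and
   n = \dim {:L}. The alias [finvect_type L] of L carries the finite field
   structure as well as the field extension structure over F.
   F_{q^n}^k is {ffun 'I_k -> finvect_type L}: its canonical vector space
   structure is the one over F, so {vspace _} denotes F_q-subspaces, while the
   F_{q^n}-scaling is written out explicitly. On row vectors over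
   [finvect_type L], the canonical vector space structure is the one over
   F_{q^n}. *)

Section LinearSets.
Variables (F : finFieldType) (L : fieldExtType F) (k : nat).
Local Notation K := (finvect_type L).
Local Notation V := {ffun 'I_k -> K}.

Definition escale (a : K) (v : V) : V := [ffun j => a * v j].

(* The F_{q^n}-line spanned by v, as a set of vectors. *)
Definition point (v : V) : {set V} := [set escale a v | a : K].

Definition linear_set (U : {vspace V}) : {set {set V}} :=
  [set point v | v in [set v : V | (v \in U) && (v != 0)]].

(* A point is closed under F-linear combinations (see mem_point_span), so the
   span only repackages it as an F-subspace. *)
Definition point_weight (U : {vspace V}) (P : {set V}) : nat :=
  \dim (<<enum P>> :&: U)%VS.

Definition regular_fat (U : {vspace V}) (r i : nat) : Prop :=
  [/\ (2 <= i)%N,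
      #|[set P in linear_set U | point_weight U P == i]| = r,
      forall P, P \in linear_set U ->
        point_weight U P = i \/ point_weight U P = 1%N
    & exists2 P, P \in linear_set U & point_weight U P = 1%N].

Lemma mem_span_closed (S : {set V}) :
  0 \in S -> {in S &, forall (x y : V), x + y \in S} ->
  (forall (c : F) (x : V), x \in S -> c *: x \in S) ->
  <<enum S>>%VS =i S.
Proof.
move=> S0 SD SZ u; apply/idP/idP => [/coord_span-> | uS]; last first.
  by rewrite memv_span // mem_enum.
apply: (@big_ind _ (fun w => w \in S)) => [|x y|i _].
- exact: S0.
- exact: SD.
apply: SZ.
by rewrite -mem_enum mem_nth //= -cardE.
Qed.

Lemma mem_point_span (v : V) : <<enum (point v)>>%VS =i point v.
Proof.
apply: mem_span_closed => [|x y|c x].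
- by apply/imsetP; exists 0 => //; apply/ffunP => j; rewrite !ffunE mul0r.
- case/imsetP=> a _ -> /imsetP[b _ ->]; apply/imsetP; exists (a + b) => //.
  by apply/ffunP => j; rewrite !ffunE mulrDl.
- case/imsetP=> a _ ->; apply/imsetP; exists (c *: a) => //.
  by apply/ffunP => j; rewrite !ffunE scalerAl.
Qed.

End LinearSets.

Section Duality.
Variables (F : finFieldType) (L : fieldExtType F) (k : nat).
Local Notation K := (finvect_type L).
Local Notation V := {ffun 'I_k -> K}.
Variable theta : {rmorphism K -> K}.
Variable sigma : {bilinear 'rV[K]_k -> 'rV[K]_k -> K | *%R & theta \; *%R}.

Definition reflexive_form : Prop := forall u v, sigma u v = 0 -> sigma v u = 0.

Definition nondegenerate_form : Prop :=
  forall u, (forall v, sigma u v = 0) -> u = 0.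

Definition ftrace (x : K) : K := \sum_(j < \dim {:L}) x ^+ (#|F| ^ j).

Definition vrow (v : V) : 'rV[K]_k := \row_j v j.

Definition sigma' (u v : V) : K := ftrace (sigma (vrow u) (vrow v)).

Definition dual_set (U : {vspace V}) : {set V} :=
  [set v : V | [forall u : V, (u \in U) ==> (sigma' u v == 0)]].

(* dual_set U is closed under F-linear combinations (see mem_dual), so the
   span only repackages it as an F-subspace. *)
Definition dual (U : {vspace V}) : {vspace V} := <<enum (dual_set U)>>%VS.

Lemma ftraceD : {morph ftrace : x y / x + y}.
Proof.
move=> x y; rewrite /ftrace -big_split; apply: eq_bigr => j _ /=.
have [p pr_p pcharF] := finPcharP F.
have pcharK : p \in [pchar K] by rewrite (fmorph_pchar (in_alg K)).
apply: exprDn_pchar; rewrite (eq_pnat _ (pcharf_eq pcharK)) pnatX.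
have /abelem_pgroup := fin_ring_pchar_abelem pcharF.
by rewrite /pgroup cardsT => ->.
Qed.

Lemma ftraceZ (a x : K) : a ^+ #|F| = a -> ftrace (a * x) = a * ftrace x.
Proof.
move=> aF; rewrite /ftrace mulr_sumr; apply: eq_bigr => j _; rewrite exprMn.
congr (_ * _); elim: (j : nat) => [|m IHm]; first by rewrite expr1.
by rewrite expnSr exprM IHm.
Qed.

Lemma mem_dual (U : {vspace V}) : dual U =i dual_set U.
Proof.
apply: mem_span_closed => [|x y|c x].
- rewrite inE; apply/forallP => u; apply/implyP => _; apply/eqP.
  rewrite /sigma'; have ->: vrow 0 = 0 by apply/rowP => j; rewrite !mxE ffunE.
  rewrite linear0; apply: (addIr (ftrace 0)).
  by rewrite -ftraceD !add0r.
- rewrite !inE => /forallP Hx /forallP Hy; apply/forallP => u; apply/implyP => uU.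
  have ->: sigma' u (x + y) = sigma' u x + sigma' u y.
    rewrite /sigma' -ftraceD -linearD; congr (ftrace (sigma _ _)).
    by apply/rowP => j; rewrite !mxE ffunE.
  by rewrite (eqP (implyP (Hx u) uU)) (eqP (implyP (Hy u) uU)) addr0.
- rewrite !inE => /forallP Hx; apply/forallP => u; apply/implyP => uU.
  have ->: sigma' u (c *: x) = theta (c%:A) * sigma' u x.
    rewrite /sigma' -ftraceZ; last first.
      by rewrite -rmorphXn -(rmorphXn (in_alg K)) expf_card.
    congr ftrace; rewrite -[RHS]linearZ; congr (sigma _ _).
    by apply/rowP => j; rewrite !mxE ffunE mulr_algl.
  by rewrite (eqP (implyP (Hx u) uU)) mulr0.
Qed.

End Duality.

Section Codes.
Variables (F : finFieldType) (L : fieldExtType F).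
Local Notation K := (finvect_type L).

Definition rank_weight N (c : 'rV[K]_N) : nat :=
  \dim <<[seq c ord0 j | j : 'I_N]>>%VS.

Definition rank_metric_code N (C : {vspace 'rV[K]_N}) (N0 k d : nat) : Prop :=
  [/\ N = N0, \dim C = k,
      exists c, [/\ c \in C, c != 0 & rank_weight c = d]
    & forall c, c \in C -> c != 0 -> (d <= rank_weight c)%N].

Definition num_codewords N (C : {vspace 'rV[K]_N}) (w : nat) : nat :=
  #|[set c : 'rV[K]_N | (c \in C) && (rank_weight c == w)]|.

Definition generator_mx k N (X : N.-tuple {ffun 'I_k -> K}) : 'M[K]_(k, N) :=
  \matrix_(i, j) tnth X j i.

Definition associated_code k N (X : N.-tuple {ffun 'I_k -> K}) :
    {vspace 'rV[K]_N} :=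
  <<[seq row i (generator_mx X) | i : 'I_k]>>%VS.

End Codes.

(* Main.v *)
Require Import Defs.
From HB Require Import structures.
From mathcomp Require Import all_boot all_order all_algebra all_field.
From mathcomp Require Import all_fingroup all_solvable zify.

Set Implicit Arguments.
Unset Strict Implicit.
Unset Printing Implicit Defensive.

Import GRing.Theory.
Local Open Scope ring_scope.

(** Write q for the order of F, n for the degree of L over F, and V for the
    space of k-tuples over L, regarded as an F-space of dimension nk.

    Instead of the dot product with a row vector, every codeword is described
    by the form sigma itself. A vector u gives the F_{q^n}-linear functional
    w |-> theta^-1 (sigma u w), where the inverse of theta turns semilinearity
    in w into linearity; evaluating it on the basis X of the dual W of U gives
    a word of the code ([codeword]). The rank of that word is the dimension of
    the image of W, so it is dim W minus the dimension of
    {w in W | sigma u w = 0}. As the trace pairing is nondegenerate, sigma u w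
    vanishes exactly when sigma' (a u) w does for every scalar a, so this
    kernel is the dual of U + <u> ([dual_point_kernel]). Since
    dim S + dim S^dual = nk for every F-subspace S ([dim_dual]), the rank is
    dim (U + <u>) - dim U = n - dim (U :&: <u>), that is n minus the weight of
    the point <u> ([rank_weight_codeword]).

    All weights of points being less than n, no nonzero u gives the zero word;
    the q^(nk) words so obtained are distinct and fill the code, whose
    dimension is at most k by construction ([codeP], [dim_associated_code]).
    Counting codewords of rank n - j thus means counting nonzero vectors u
    whose point has weight j. For j > 0 these are the points of weight j in
    L_U, with q^n - 1 vectors each; for j = 0 they are the nonzero vectors
    outside all the points of L_U. *)

(** * Counting with additive maps *)

Section Counting.
Variables (F : finFieldType) (L : fieldExtType F).
Local Notation K := (finvect_type L).

Lemma card_fieldext : #|K| = (#|F| ^ \dim {:L})%N.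
Proof.
rewrite -(@card_vspace F K _ (fullv : {vspace K})).
by apply: eq_card => x; rewrite memvf.
Qed.

(** Every fibre is a translate of the kernel. This finite form of the rank
    formula also covers maps, such as sigma' u, which are only semilinear. *)
Lemma card_additive_image k (R : finZmodType) (f : {ffun 'I_k -> K} -> R)
    (D : {set {ffun 'I_k -> K}}) :
  {in D &, forall x y, x + y \in D} -> {in D &, forall x y, x - y \in D} ->
  {morph f : x y / x - y} ->
  #|D| = (#|[set f w | w in D]| * #|[set w in D | f w == 0%R]|)%N.
Proof.
move=> DD DB fB; rewrite -sum1_card (partition_big_imset f) /= -sum_nat_const.
apply: eq_bigr => _ /imsetP[v vD ->]; rewrite sum1dep_card.
have inj : injective (fun w => w + v) by exact: addIr.
rewrite -[RHS](card_imset _ inj); apply: eq_card => w; rewrite inE.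
apply/andP/imsetP => [[wD /eqP fwv] | [x]].
  by exists (w - v); rewrite ?subrK // inE DB //= fB fwv subrr.
rewrite inE => /andP[xD /eqP fx0] ->; split; first exact: DD.
by rewrite -subr_eq0 -fB addrK fx0.
Qed.

End Counting.

(** * The trace form *)

Section Trace.
Variables (F : finFieldType) (L : fieldExtType F).
Local Notation K := (finvect_type L).

Lemma frobeniusD (x y : K) : (x + y) ^+ #|F| = x ^+ #|F| + y ^+ #|F|.
Proof.
have [p pr_p pcharF] := finPcharP F.
have pcharK : p \in [pchar K] by rewrite (fmorph_pchar (in_alg K)).
apply: exprDn_pchar; rewrite (eq_pnat _ (pcharf_eq pcharK)).
by have /abelem_pgroup := fin_ring_pchar_abelem pcharF; rewrite /pgroup cardsT.
Qed.

(** Raising to the power q permutes the summands of the trace cyclically, and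
    F is the fixed field of that map. *)
Lemma ftrace_base (x : K) : exists c : F, ftrace x = c%:A.
Proof.
suff /vlineP[c ->] : ftrace x \in 1%AS by exists c.
have frob0 : 0 ^+ #|F| = 0 :> K.
  by rewrite expr0n (gtn_eqF (ltnW (finNzRing_gt1 F))).
rewrite Fermat's_little_theorem dimv1 expn1 /ftrace.
rewrite (big_morph (fun y : K => y ^+ #|F|) frobeniusD frob0).
have [m dimL] : exists m, \dim {:L} = m.+1.
  by case: (\dim {:L}) (adim_gt0 {:L}%AS) => // m _; exists m.
rewrite dimL big_ord_recr [X in _ == X]big_ord_recl /= expr1 addrC.
rewrite -exprM -expnSr -dimL -card_fieldext expf_card.
apply/eqP; congr (_ + _).
by apply: eq_bigr => j _; rewrite -exprM -expnSr.
Qed.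

(** The trace is a nonzero polynomial function of degree q^(n-1), so it cannot
    vanish at all the q^n elements of the field. *)
Lemma ftrace_neq0 : exists x : K, ftrace x != 0.
Proof.
have [m dimL] : exists m, \dim {:L} = m.+1.
  by case: (\dim {:L}) (adim_gt0 {:L}%AS) => // m _; exists m.
have q_gt1 : (1 < #|F|)%N := finNzRing_gt1 F.
pose p : {poly K} := \sum_(j < \dim {:L}) 'X^(#|F| ^ j).
have p_neq0 : p != 0.
  suff: p`_1 != 0 by apply: contraNneq => ->; rewrite coef0.
  rewrite coef_sum dimL big_ord_recl coefXn eqxx big1 ?addr0 ?oner_eq0 //.
  move=> j _.
  by rewrite coefXn [_ == _](_ : _ = false) // ltn_eqF // -[1%N](expn0 #|F|)
    ltn_exp2l.
have size_p : (size p <= (#|F| ^ m).+1)%N.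
  apply: (leq_trans (size_sum _ _ _)); apply/bigmax_leqP => j _.
  by rewrite size_polyXn ltnS leq_exp2l // -ltnS -dimL.
apply/existsP; apply: contraLR (size_p); rewrite negb_exists => /forallP tr0.
rewrite -ltnNge; apply: leq_trans (max_poly_roots p_neq0 _ (enum_uniq K)).
  by rewrite -cardE card_fieldext dimL ltnS ltn_exp2l.
apply/allP => x _; rewrite /root /p horner_sum.
under eq_bigr do rewrite hornerXn.
by have := tr0 x; rewrite negbK.
Qed.

Lemma ftrace_nondegenerate (x : K) : (forall a, ftrace (a * x) = 0) -> x = 0.
Proof.
move=> tr0; apply/eqP; have [y] := ftrace_neq0.
by apply: contraNT => x0; rewrite -(tr0 (y / x)) divfK.
Qed.

Lemma ftraceB : {morph @ftrace F L : x y / x - y}.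
Proof.
move=> x y; have m1F : (- 1) ^+ #|F| = - 1 :> K.
  by rewrite -[- 1](rmorphN1 (in_alg K)) -rmorphXn expf_card.
by rewrite -mulN1r ftraceD ftraceZ // mulN1r.
Qed.

Lemma ftrace0 : ftrace (0 : K) = 0.
Proof. by have := ftraceB 0 0; rewrite !subrr. Qed.

End Trace.

(** * The dual of a subspace *)

Section Duality.
Variables (F : finFieldType) (L : fieldExtType F) (k : nat).
Local Notation K := (finvect_type L).
Local Notation V := {ffun 'I_k -> K}.
Variable theta : {rmorphism K -> K}.
Variable sigma : {bilinear 'rV[K]_k -> 'rV[K]_k -> K | *%R & theta \; *%R}.

Lemma card_space : #|{: V}| = (#|F| ^ (\dim {:L} * k))%N.
Proof. by rewrite card_ffun card_ord card_fieldext expnM. Qed.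

Lemma dim_space : \dim {: V}%VS = (\dim {:L} * k)%N.
Proof.
apply/eqP; rewrite -(eqn_exp2l _ _ (finNzRing_gt1 F)) -card_space -card_vspace.
by apply/eqP/eq_card => x; rewrite memvf.
Qed.

Lemma vrowB : {morph @vrow F L k : u v / u - v}.
Proof. by move=> u v; apply/rowP => j; rewrite !mxE !ffunE. Qed.

Lemma vrowP (c : F) (u v : V) : vrow (c *: u + v) = c%:A *: vrow u + vrow v.
Proof. by apply/rowP => j; rewrite !mxE !ffunE mulr_algl. Qed.

Lemma vrow_escale a (u : V) : vrow (escale a u) = a *: vrow u.
Proof. by apply/rowP => j; rewrite !mxE !ffunE. Qed.

Lemma vrow_sum (w : V) : vrow w = \sum_l w l *: delta_mx 0 l.
Proof. by rewrite [LHS]row_sum_delta; apply: eq_bigr => l _; rewrite mxE. Qed.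

Lemma vrow_surj (x : 'rV[K]_k) : vrow [ffun j => x 0 j] = x.
Proof. by apply/rowP => j; rewrite !mxE ffunE. Qed.

Lemma sigma'B (u : V) : {morph sigma' sigma u : v w / v - w}.
Proof. by move=> v w; rewrite /sigma' vrowB linearBr ftraceB. Qed.

Lemma sigma'P (c : F) (u v w : V) :
  sigma' sigma (c *: u + v) w = c%:A * sigma' sigma u w + sigma' sigma v w.
Proof.
rewrite /sigma' vrowP linearDl linearZl_LR ftraceD ftraceZ //.
by rewrite -(rmorphXn (in_alg K)) expf_card.
Qed.

Lemma mem_dualP (S : {vspace V}) (w : V) :
  reflect (forall u, u \in S -> sigma' sigma u w = 0) (w \in dual sigma S).
Proof.
rewrite mem_dual inE; apply: (iffP forallP) => H u.
  by move=> uS; apply/eqP/(implyP (H u)).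
by apply/implyP => uS; rewrite H.
Qed.

(** Passing from sigma' back to sigma: w is sigma'-orthogonal to the whole
    point of u if and only if it is sigma-orthogonal to u. *)
Lemma sigma_eq0P (u w : V) :
  reflect (forall a, sigma' sigma (escale a u) w = 0)
          (sigma (vrow u) (vrow w) == 0).
Proof.
have sE a : sigma' sigma (escale a u) w = ftrace (a * sigma (vrow u) (vrow w)).
  by rewrite /sigma' vrow_escale linearZl_LR.
apply: (iffP eqP) => [s0 a | H].
  by rewrite sE s0 mulr0 ftrace0.
by apply: ftrace_nondegenerate => a; rewrite -sE.
Qed.

(** The dual of S is the kernel of the map sending w to its pairings with a
    basis of S; these pairings lie in F, so the image has at most q^(dim S)
    elements. Counting replaces rank-nullity because the map is only
    semilinear over F. *)
Lemma dim_dual_ge (S : {vspace V}) :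
  (\dim {:L} * k <= \dim S + \dim (dual sigma S))%N.
Proof.
set m := \dim S; pose b j := (vbasis S)`_j.
pose f w : 'rV[K]_m := \row_j sigma' sigma (b j) w.
have fB : {morph f : x y / x - y}.
  by move=> x y; apply/rowP => j; rewrite !mxE sigma'B.
have := @card_additive_image F L k _ f setT (fun _ _ _ _ => in_setT _)
  (fun _ _ _ _ => in_setT _) fB.
rewrite cardsT card_space => cardV.
rewrite -(leq_exp2l _ _ (finNzRing_gt1 F)) cardV expnD.
apply: leq_mul.
  pose g (x : 'rV[F]_m) := map_mx (in_alg K) x.
  have -> : (#|F| ^ m)%N = #|{: 'rV[F]_m}| by rewrite card_mx mul1n.
  apply: leq_trans (leq_imset_card g _); apply/subset_leq_card/subsetP => y.
  case/imsetP => w _ ->; apply/imsetP.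
  have /fin_all_exists[c cE] j : exists c : F, f w 0 j = c%:A.
    by rewrite mxE; exact: ftrace_base.
  by exists (\row_j c j) => //; apply/rowP => j; rewrite cE !mxE.
rewrite -card_vspace; apply/subset_leq_card/subsetP => w.
rewrite !inE => /eqP fw0; apply/mem_dualP => u /coord_vbasis ->.
have s0 : sigma' sigma 0 w = 0 by have := sigma'P (- 1) 0 0 w;
  rewrite addr0 scaler0 scaleN1r mulN1r addNr.
apply: (@big_ind _ (fun u => sigma' sigma u w = 0)) => // [x y x0 y0 | j _].
  by rewrite -[x]scale1r sigma'P x0 y0 mulr0 addr0.
have bj0 : sigma' sigma (b j) w = 0 by have /rowP/(_ j) := fw0; rewrite !mxE.
by rewrite -[_ *: _]addr0 sigma'P bj0 mulr0 s0 addr0.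
Qed.

Hypothesis sigma_refl : reflexive_form sigma.
Hypothesis sigma_nondeg : nondegenerate_form sigma.

(** The duals of S and of a complement of S meet trivially, so their
    dimensions add up to at most nk, while [dim_dual_ge] bounds each of them
    from below by the complementary dimension. *)
Lemma dim_dual (S : {vspace V}) :
  (\dim S + \dim (dual sigma S))%N = (\dim {:L} * k)%N.
Proof.
have dual0 : (dual sigma S :&: dual sigma S^C)%VS = 0%VS.
  apply/eqP; rewrite -subv0; apply/subvP => w; rewrite memv_cap memv0.
  case/andP => /mem_dualP wS /mem_dualP wSC.
  have w0 u : sigma (vrow u) (vrow w) = 0.
    apply/eqP/sigma_eq0P => a; have : escale a u \in (S + S^C)%VS.
      by rewrite addv_complf memvf.
    case/memv_addP => x xS [y yS ->].
    by rewrite -[x]scale1r sigma'P wS // wSC // mulr0 addr0.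
  have : vrow w = 0.
    by apply: sigma_nondeg => x; apply: sigma_refl; rewrite -(vrow_surj x) w0.
  by move=> /rowP wr0; apply/eqP/ffunP => j; have := wr0 j; rewrite !mxE ffunE.
apply/eqP; rewrite eqn_leq dim_dual_ge andbT.
have := dimvS (subvf (dual sigma S + dual sigma S^C)).
rewrite dimv_disjoint_sum //.
have := dim_dual_ge S^C; rewrite dimv_compl dim_space.
have := dimvS (subvf S); rewrite dim_space.
move=> SN; rewrite -leq_subLR subKn // => SC dualN.
by apply: leq_trans dualN; rewrite addnC leq_add2l.
Qed.

End Duality.

(** * Points and their weights *)

Section Points.
Variables (F : finFieldType) (L : fieldExtType F) (k : nat).
Local Notation K := (finvect_type L).
Local Notation V := {ffun 'I_k -> K}.
Implicit Types (U : {vspace V}) (u v : V).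

Lemma escaleA a b u : escale a (escale b u) = escale (a * b) u.
Proof. by apply/ffunP => j; rewrite !ffunE mulrA. Qed.

Lemma escale1 u : escale 1 u = u.
Proof. by apply/ffunP => j; rewrite !ffunE mul1r. Qed.

Lemma escale0 u : escale 0 u = 0.
Proof. by apply/ffunP => j; rewrite !ffunE mul0r. Qed.

Lemma mem_point u : u \in point u.
Proof. by apply/imsetP; exists 1; rewrite ?escale1. Qed.

Lemma card_point u : u != 0 -> #|point u| = #|K|.
Proof.
move=> u_neq0; apply: card_imset => a b /ffunP eq_ab.
have [j uj] : exists j, u j != 0.
  apply/existsP; apply: contraNT u_neq0; rewrite negb_exists => /forallP u0.
  by apply/eqP/ffunP => j; rewrite ffunE; apply/eqP; rewrite -[_ == _]negbK.
by have := eq_ab j; rewrite !ffunE => /(mulIf uj).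
Qed.

Lemma eq_point u v : v \in point u -> v != 0 -> point v = point u.
Proof.
case/imsetP => a _ -> au0; have a0 : a != 0.
  by apply: contraNneq au0 => ->; rewrite escale0.
apply/setP => w; apply/imsetP/imsetP => -[b _ ->].
  by exists (b * a); rewrite ?escaleA.
by exists (b / a); rewrite ?escaleA ?divfK.
Qed.

Lemma dim_point u : u != 0 -> \dim <<enum (point u)>>%VS = \dim {:L}.
Proof.
move=> u0; apply/eqP; rewrite -(eqn_exp2l _ _ (finNzRing_gt1 F)) -card_fieldext.
by rewrite -(card_point u0) -card_vspace (eq_card (mem_point_span u)).
Qed.

Lemma point_weight_gt0 U u :
  u != 0 -> (0 < point_weight U (point u))%N = (point u \in linear_set U).
Proof.
move=> u0; rewrite /point_weight lt0n dimv_eq0; apply/idP/imsetP => [W0 | [v]].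
  have := memv_pick (<<enum (point u)>> :&: U)%VS.
  rewrite memv_cap mem_point_span => /andP[vu vU]; rewrite -vpick0 in W0.
  by exists (vpick (<<enum (point u)>> :&: U)%VS);
    rewrite ?inE ?vU ?(eq_point vu).
rewrite inE => /andP[vU v0] uv; apply: contraNneq v0 => W0.
by rewrite -memv0 -W0 memv_cap mem_point_span uv mem_point.
Qed.

(** Distinct points share only the zero vector. *)
Lemma card_union_points (S : {set {set V}}) :
  (forall P, P \in S -> exists2 v : V, v != 0 & P = point v) ->
  #|[set u : V | (u != 0) && (point u \in S)]| = (#|S| * (#|K| - 1))%N.
Proof.
move=> Spt; rewrite -sum1_card -sum_nat_const.
rewrite (partition_big (@point F L k) (mem S)) /= => [|u]; last first.
  by rewrite inE => /andP[].
apply: eq_bigr => P PS; have [v v0 defP] := Spt P PS; rewrite sum1dep_card.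
rewrite -(card_point v0) (cardsD1 (0 : V) (point v)).
have -> /= : (0 : V) \in point v by apply/imsetP; exists 0; rewrite ?escale0.
rewrite add1n subn1 /=; apply: eq_card => u; rewrite !inE.
have [-> //|u0 /=] := eqVneq u 0; apply/andP/idP => [[_ /eqP uP] | uv].
  by rewrite -defP -uP mem_point.
by rewrite (eq_point uv u0) -defP PS.
Qed.

End Points.

(** * Codewords as functionals on the dual *)

Section Code.
Variables (F : finFieldType) (L : fieldExtType F) (k : nat).
Local Notation K := (finvect_type L).
Local Notation V := {ffun 'I_k -> K}.
Variable theta : {rmorphism K -> K}.
Variable sigma : {bilinear 'rV[K]_k -> 'rV[K]_k -> K | *%R & theta \; *%R}.

(** The inverse of theta makes this functional linear in w; it is only
    theta^-1-semilinear in u. *)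
Definition dual_functional (u w : V) : K :=
  invF (fmorph_inj theta) (sigma (vrow u) (vrow w)).

Lemma theta_dual_functional u w :
  theta (dual_functional u w) = sigma (vrow u) (vrow w).
Proof. exact: f_invF. Qed.

Lemma dual_functional_eq0 u w :
  (dual_functional u w == 0) = (sigma (vrow u) (vrow w) == 0).
Proof. by rewrite -(fmorph_eq0 theta) theta_dual_functional. Qed.

Lemma dual_functionalBl w : {morph dual_functional ^~ w : u v / u - v}.
Proof.
move=> u v /=; apply: (fmorph_inj theta).
by rewrite rmorphB !theta_dual_functional vrowB linearBl.
Qed.

Lemma dual_functional_is_linear u : linear (dual_functional u).
Proof.
move=> c v w; apply: (fmorph_inj theta).
rewrite -[c *: dual_functional u v]mulr_algl rmorphD rmorphM.
by rewrite !theta_dual_functional vrowP linearPr.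
Qed.

HB.instance Definition _ u :=
  GRing.isLinear.Build F V K _ (dual_functional u) (dual_functional_is_linear u).

(** The coefficients are those of the row by which the generator matrix is to
    be multiplied in order to obtain the word of u. *)
Lemma dual_functional_sum u w :
  dual_functional u w =
    \sum_l invF (fmorph_inj theta) (sigma (vrow u) (delta_mx 0 l)) * w l.
Proof.
apply: (fmorph_inj theta); rewrite theta_dual_functional (vrow_sum w) linear_sumr.
rewrite rmorph_sum; apply: eq_bigr => l _.
by rewrite rmorphM f_invF linearZr_LR mulrC.
Qed.

Variables (N : nat) (X : N.-tuple V).

Definition codeword (u : V) : 'rV[K]_N := \row_j dual_functional u (tnth X j).

Lemma codewordB : {morph codeword : u v / u - v}.
Proof. by move=> u v; apply/rowP => j; rewrite !mxE dual_functionalBl. Qed.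

Lemma codeword_in_code u : codeword u \in associated_code X.
Proof.
pose x := \row_l invF (fmorph_inj theta) (sigma (vrow u) (delta_mx 0 l)).
have -> : codeword u = x *m generator_mx X.
  apply/rowP => j; rewrite !mxE dual_functional_sum.
  by apply: eq_bigr => l _; rewrite !mxE.
rewrite mulmx_sum_row memv_suml // => l _; rewrite memvZ // memv_span //.
by apply/imageP; exists l.
Qed.

Variable U : {vspace V}.
Hypothesis sigma_refl : reflexive_form sigma.
Hypothesis sigma_nondeg : nondegenerate_form sigma.
Hypothesis X_basis : basis_of (dual sigma U) X.

Lemma codeword_span u :
  <<[seq codeword u ord0 j | j : 'I_N]>>%VS =
    (linfun (dual_functional u) @: dual sigma U)%VS.
Proof.
rewrite -(span_basis X_basis) limg_span; congr <<_>>%VS.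
rewrite (eq_map (lfunE _)) -[in RHS](map_tnth_enum X) -map_comp.
by apply: eq_map => j; rewrite /= mxE.
Qed.

(** This identifies the kernel of the functional of u on the dual of U as
    another dual, so that [dim_dual] gives its dimension. *)
Lemma dual_point_kernel u w :
  (w \in dual sigma (U + <<enum (point u)>>)) =
  (w \in dual sigma U) && (dual_functional u w == 0).
Proof.
rewrite dual_functional_eq0.
apply/mem_dualP/andP => [H | [/mem_dualP wU /sigma_eq0P wu] _
    /memv_addP[x xU [y yu ->]]].
  split; first by apply/mem_dualP => v vU; apply: H; rewrite (subvP (addvSl _ _)).
  apply/sigma_eq0P => a; apply: H; rewrite (subvP (addvSr _ _)) // mem_point_span.
  by apply/imsetP; exists a.
move: yu; rewrite mem_point_span => /imsetP[a _ ->].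
by rewrite -[x]scale1r sigma'P wU // wu mulr0 addr0.
Qed.

(** The functional of u maps the dual of U onto the span of the entries of the
    word of u, with kernel the dual of U + <u>. Comparing the dimensions of
    the two duals, the rank is dim (U + <u>) - dim U. *)
Lemma rank_weight_codeword (u : V) : u != 0 ->
  (rank_weight (codeword u) + point_weight U (point u))%N = \dim {:L}.
Proof.
move=> u0; set P := <<enum (point u)>>%VS.
have cardW : (#|F| ^ \dim (dual sigma U) =
    #|F| ^ rank_weight (codeword u) * #|F| ^ \dim (dual sigma (U + P)))%N.
  rewrite /rank_weight codeword_span -!card_vspace.
  have := @card_additive_image F L k _ (dual_functional u) [set w in dual sigma U].
  rewrite cardsE => -> //; first last.
  - exact: raddfB.
  - by move=> x y; rewrite !inE; apply: rpredB.
  - by move=> x y; rewrite !inE; apply: rpredD.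
  congr (_ * _)%N.
    apply: eq_card => y; apply/imsetP/memv_imgP => -[w wW ->]; exists w.
    - by rewrite inE in wW.
    - by rewrite lfunE.
    - by rewrite inE.
    - by rewrite lfunE.
  by apply: eq_card => w; rewrite [RHS]dual_point_kernel !in_set.
move: cardW => /eqP; rewrite -expnD eqn_exp2l ?finNzRing_gt1 // => /eqP dimW.
have dU := dim_dual sigma_refl sigma_nondeg U.
have dUP := dim_dual sigma_refl sigma_nondeg (U + P).
have := dimv_sum_cap U P; rewrite (dim_point u0) capvC => dimUP.
have arith (a b c d e f g m : nat) :
  b = (c + d)%N -> (a + b = m -> e + d = m -> e + f = a + g -> c + f = g)%N by lia.
exact: arith dimW dU dUP dimUP.
Qed.

Hypothesis point_weight_lt :
  forall u : V, u != 0 -> (point_weight U (point u) < \dim {:L})%N.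

Lemma rank_weight0 : rank_weight (0 : 'rV[K]_N) = 0%N.
Proof.
apply/eqP; rewrite dimv_eq0 -subv0; apply/span_subvP => _ /mapP[j _ ->].
by rewrite mxE mem0v.
Qed.

Lemma codeword_inj : injective codeword.
Proof.
move=> u v /eqP; rewrite -subr_eq0 -codewordB => /eqP uv0; apply/eqP.
rewrite -subr_eq0; apply: contraT => uv_neq0.
have := rank_weight_codeword uv_neq0; rewrite uv0 rank_weight0 add0n => wn.
by have := point_weight_lt uv_neq0; rewrite wn ltnn.
Qed.

Lemma dim_code_le : (\dim (associated_code X) <= k)%N.
Proof. by apply: leq_trans (dim_span _) _; rewrite size_image card_ord. Qed.

Lemma card_codeword_image :
  #|[set codeword u | u : V]| = (#|K| ^ k)%N.
Proof. by rewrite (card_imset _ codeword_inj) card_ffun card_ord. Qed.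

Lemma codeword_image_sub :
  [set codeword u | u : V] \subset associated_code X.
Proof. by apply/subsetP => _ /imsetP[u _ ->]; exact: codeword_in_code. Qed.

(** The code contains the q^(nk) distinct words of the vectors u, whereas k
    generators cannot span more than that. *)
Lemma dim_associated_code : \dim (associated_code X) = k.
Proof.
apply/eqP; rewrite eqn_leq dim_code_le -(leq_exp2l _ _ (finNzRing_gt1 K)).
rewrite -card_vspace -card_codeword_image.
exact/subset_leq_card/codeword_image_sub.
Qed.

Lemma codeP c : reflect (exists u, c = codeword u) (c \in associated_code X).
Proof.
suff <- : (c \in [set codeword u | u : V]) = (c \in associated_code X).
  by apply: (iffP imsetP) => [[u _ ->] | [u ->]]; exists u.
apply: subset_cardP codeword_image_sub _.
by rewrite card_codeword_image card_vspace dim_associated_code.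
Qed.

Lemma num_codewordsE j : (j < \dim {:L})%N ->
  num_codewords (associated_code X) (\dim {:L} - j) =
  #|[set u : V | (u != 0) && (point_weight U (point u) == j)]|.
Proof.
move=> ltjn; rewrite -(card_imset _ codeword_inj); apply: eq_card => c.
rewrite inE; apply/andP/imsetP => [[/codeP[u ->]] | [u]].
  have [-> | u0] := eqVneq u 0.
    have -> : codeword 0 = 0 by rewrite -(subrr 0) codewordB subrr.
    by rewrite rank_weight0 eq_sym subn_eq0 leqNgt ltjn.
  have := rank_weight_codeword u0 => wu /eqP rwu.
  exists u; rewrite // inE u0 -(eqn_add2l (rank_weight (codeword u))) wu rwu.
  by rewrite subnK ?(ltnW ltjn) /=.
rewrite inE => /andP[u0 /eqP wj] ->; split; first exact: codeword_in_code.
by rewrite -(rank_weight_codeword u0) wj addnK.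
Qed.

End Code.

(** * Weight distribution for regular fat linear sets *)

Section RegularFat.
Variables (F : finFieldType) (L : fieldExtType F) (k : nat).
Local Notation K := (finvect_type L).
Local Notation V := {ffun 'I_k -> K}.
Variables (U : {vspace V}) (r i : nat).
Hypothesis U_fat : regular_fat U r i.

Lemma linear_setP (P : {set V}) :
  P \in linear_set U -> exists2 v : V, v != 0 & P = point v.
Proof. by case/imsetP => v; rewrite inE => /andP[_ v0] ->; exists v. Qed.

Lemma regular_fat_le (u : V) : u != 0 -> (point_weight U (point u) <= i)%N.
Proof.
move=> u0; have [i2 _ wt _] := U_fat.
have [|] := posnP (point_weight U (point u)); first by move=> ->.
by rewrite point_weight_gt0 // => /wt[] ->; rewrite // ltnW.
Qed.

Lemma card_vectors_of_weight j : (0 < j)%N ->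
  #|[set u : V | (u != 0) && (point_weight U (point u) == j)]| =
  (#|[set P in linear_set U | point_weight U P == j]| * (#|K| - 1))%N.
Proof.
move=> j0; rewrite -card_union_points => [|P]; last first.
  by rewrite inE => /andP[/linear_setP].
apply: eq_card => u; rewrite !inE; have [//|u0 /=] := eqVneq u 0.
rewrite -point_weight_gt0 //; have [->|] := eqVneq; last by rewrite andbF.
by rewrite j0.
Qed.

Lemma card_vectors_of_weight0 :
  #|[set u : V | (u != 0) && (point_weight U (point u) == 0%N)]| =
  (#|{: V}| - 1 - #|linear_set U| * (#|K| - 1))%N.
Proof.
rewrite -(card_union_points linear_setP).
set A := finset _; set B := finset _.
have -> : A = [set~ (0 : V)] :\: B.
  apply/setP => u; rewrite !inE; have [//|u0 /=] := eqVneq u 0.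
  by rewrite andbT -point_weight_gt0 // eqn0Ngt.
rewrite cardsD (setIidPr _); last by apply/subsetP => u; rewrite !inE => /andP[].
by rewrite cardsC1 subn1.
Qed.

Lemma card_points_of_weight1 :
  #|[set P in linear_set U | point_weight U P == 1%N]| = (#|linear_set U| - r)%N.
Proof.
have [i2 <- wt _] := U_fat.
rewrite -(cardsID [set P | point_weight U P == i] (linear_set U)) -setIdE addKn.
apply: eq_card => P; rewrite !inE.
have [/wt|] := boolP (P \in linear_set U); last by rewrite andbF.
by case=> ->; rewrite eqxx ?(gtn_eqF i2) ?(ltn_eqF i2).
Qed.

End RegularFat.

Theorem proposition5p6
  (q n k : nat) (F : finFieldType) (L : fieldExtType F)
  (hq : #|F| = q) (hL : \dim {:L} = n) (hn : (1 < n)%N) (hk : (1 < k)%N)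
  (theta : {rmorphism finvect_type L -> finvect_type L})
  (sigma : {bilinear 'rV[finvect_type L]_k -> 'rV[finvect_type L]_k ->
              finvect_type L | *%R & theta \; *%R})
  (hrefl : reflexive_form sigma) (hnd : nondegenerate_form sigma)
  (U : {vspace {ffun 'I_k -> finvect_type L}})
  (rho r i : nat) (hrho : \dim U = rho)
  (hfat : regular_fat U r i) (hi : (i < n)%N)
  (N : nat) (X : N.-tuple {ffun 'I_k -> finvect_type L})
  (hX : basis_of (dual sigma U) X) :
  let C := associated_code X in
  [/\ N = (n * k - rho)%N /\ \dim C = k,
      (* for r = 0 the minimum distance is n - 1, not n - i *)
      (0 < r)%N -> rank_metric_code C (n * k - rho) k (n - i),
      num_codewords C (n - i) = (r * (q ^ n - 1))%N,
      num_codewords C (n - 1) = ((#|linear_set U| - r) * (q ^ n - 1))%N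
    & num_codewords C n = (q ^ (n * k) - 1 - #|linear_set U| * (q ^ n - 1))%N].
Proof.
move=> C; have [i2 hr _ _] := hfat.
have wt_lt u : u != 0 -> (point_weight U (point u) < \dim {:L})%N.
  by move=> u0; rewrite hL; apply: leq_ltn_trans (regular_fat_le hfat u0) hi.
have defN : N = (n * k - rho)%N.
  by rewrite -(size_basis hX) -hL -(dim_dual hrefl hnd U) hrho addKn.
have dimC : \dim C = k := dim_associated_code hrefl hnd hX wt_lt.
have numE := num_codewordsE hrefl hnd hX wt_lt.
rewrite hL in numE.
have cardK : #|finvect_type L| = (q ^ n)%N by rewrite card_fieldext hq hL.
have num_i : num_codewords C (n - i) = (r * (q ^ n - 1))%N.
  by rewrite numE // card_vectors_of_weight ?hr ?cardK // ltnW.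
split=> //.
- move=> r0; split=> // [|c].
    have : (0 < num_codewords C (n - i))%N.
      by rewrite num_i muln_gt0 r0 subn_gt0 -cardK finNzRing_gt1.
    case/card_gt0P => c; rewrite inE => /andP[cC /eqP wc].
    exists c; split=> //; apply: contraTneq hi => c0.
    by rewrite -leqNgt -subn_eq0 -wc c0 rank_weight0.
  case/(codeP hrefl hnd hX wt_lt) => u -> cu0.
  have u0 : u != 0.
    by apply: contraNneq cu0 => ->; rewrite -(subrr 0) codewordB subrr.
  rewrite leq_subLR addnC -hL -(rank_weight_codeword hrefl hnd hX u0) leq_add2l.
  exact (regular_fat_le hfat u0).
- by rewrite numE // card_vectors_of_weight // (card_points_of_weight1 hfat) cardK.
by rewrite -[n in LHS]subn0 numE ?(ltnW hn) // card_vectors_of_weight0 cardK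
  card_space hq hL.
Qed.
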